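(* Let $\Psi_l:\Omega\to\mathbb{R}$ be a smooth function satisfying $$\frac{1}{\lambda}q\Psi_l-\mathcal{L}(\Psi_l)\le 0 \ \text{ on } \Omega,\qquad \Psi_l(x)\le \psi(x)\ \text{ for } x\in\partial\Omega .$$ Then $\Psi_l$ is a viscosity subsolution of the linear HJB equation $\frac1\lambda q\Psi-\mathcal{L}(\Psi)=0$ on $\Omega$, and $\Psi_l\le\Psi^*$ for all $x\in\Omega$. Likewise, let $\Psi_u:\Omega\to\mathbb{R}$ be a smooth function satisfying $$\frac{1}{\lambda}q\Psi_u-\mathcal{L}(\Psi_u)\ge 0 \ \text{ on } \Omega,\qquad \Psi_u(x)\ge \psi(x)\ \text{ for } x\in\partial\Omega .$$ Then $\Psi_u$ is a viscosity supersolution of the same equation on $\Omega$, and $\Psi_u\ge\Psi^*$ for all $x\in\Omega$.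
   Context: Setting. $\Omega=\{x\in\mathbb{R}^n: g_i(x)\ge 0,\ i=1,\dots,k\}$ with $g_i\in\mathbb{R}[x]$ is a compact basic closed semialgebraic set, $0\in\Omega$, and its boundary is described by polynomials, $\partial\Omega=\{x:\prod_{i=1}^m h_i(x)=0\}$, $h_i\in\mathbb{R}[x]$. The dynamics are $dx_t=(f(x_t)+G(x_t)u_t)\,dt+B(x_t)\,d\omega_t$ with $f,G,B$ having real polynomial entries ($f\in\mathbb{R}^n[x]$, $G\in\mathbb{R}^{n\times m'}[x]$, $B\in\mathbb{R}^{n\times l}[x]$), $f(0)=0$, $G(0)=0$, $B(0)=0$, and $\omega_t$ an $l$-dimensional Brownian motion with covariance $\Sigma_\epsilon$. The cost is $J(x,u)=\mathbb{E}_{\omega_t}[\phi(x_T)+\int_0^T q(x_t)+\frac12u_t^TRu_t\,dt]$, where $T$ is the first time the state reaches the boundary of the domain or the origin, $R$ is a symmetric positive definite matrix, and $\phi,q$ are nonnegative polynomials, positive definite on $\Omega$ (zero at $0$, positive on $\Omega\setminus\{0\}$). The origin is treated as part of the boundary on which boundary data are imposed: $\phi(0)=0$, and $\phi>0$ on $\partial\Omega\setminus\{0\}$. There is $\lambda>0$ with $\lambda G(x)R^{-1}G(x)^T=B(x)\Sigma_\epsilon B(x)^T=:\Sigma(x)$ (also written $\Sigma_t$ for $\Sigma(x_t)$). Notation. $\mathcal{L}(\Psi)=f^T\nabla_x\Psi+\frac12\mathrm{Tr}((\nabla_{xx}\Psi)\Sigma)$ and $\psi(x)=e^{-\phi(x)/\lambda}$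 on $\partial\Omega$. It is assumed throughout that there is a unique nontrivial viscosity solution $\Psi^*$ of the linear HJB equation $0=-\frac1\lambda q\Psi+\mathcal{L}(\Psi)$ on $\Omega$ with $\Psi=\psi$ on $\partial\Omega$. Viscosity solutions: for $F(x,r,p,X)$ with $F(x,r,p,X)\le F(x,s,p,Y)$ whenever $r\le s$, $Y\le X$, an upper semicontinuous $u$ is a viscosity subsolution of $F=0$ on $\Omega$ if $F(x,u(x),p,X)\le0$ for all $x\in\Omega$ and $(p,X)$ in the second-order superjet $J^{2,+}_\Omega u(x)$; a lower semicontinuous $u$ is a viscosity supersolution if $F(x,u(x),p,X)\ge0$ for all $x\in\Omega$ and $(p,X)$ in the second-order subjet $J^{2,-}_\Omega u(x)$; a viscosity solution is both. Here $F(x,r,p,X)=\frac1\lambda q(x)r-f(x)^Tp-\frac12\mathrm{Tr}(X\Sigma(x))$.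
   Formalization: The equation and the viscosity inequalities are imposed only at interior points of Ω (frontier points and the origin carry boundary data), since with relative jets at frontier points where Σ is nondegenerate no smooth function would be a viscosity subsolution. *)

(* Defs.v *)
From HB Require Import structures.
From mathcomp Require Import all_boot all_order all_algebra.
From mathcomp Require Import all_classical all_reals all_analysis.
(* [mpoly] is not imported: its notations clash with those of the analysis
   library. *)
From mathcomp Require mpoly.

Set Implicit Arguments.
Unset Strict Implicit.
Unset Printing Implicit Defensive.

Import Order.TTheory GRing.Theory Num.Theory numFieldNormedType.Exports.

Local Open Scope classical_set_scope.
Local Open Scope ring_scope.

Section LinearAlgebra.
Variables (R : realType) (n : nat).
Implicit Types (u v : 'cV[R]_n) (X Y : 'M[R]_n).

Definition dotv u v : R := (u^T *m v) 0 0.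
Definition quadf X v : R := (v^T *m X *m v) 0 0.

Definition sym_mx X : Prop := X^T = X.
Definition posdef_mx X : Prop :=
  sym_mx X /\ forall v, v != 0 -> 0 < quadf X v.
Definition possemidef_mx X : Prop :=
  sym_mx X /\ forall v, 0 <= quadf X v.

Definition loewner_le Y X : Prop := forall v, quadf Y v <= quadf X v.

End LinearAlgebra.

Section Polynomials.
Variables (R : realType) (n : nat).
Implicit Types x : 'cV[R]_n.

Definition peval (p : mpoly.mpoly n R) x : R :=
  mpoly.meval (fun i => x i 0) p.

Definition peval_mx (a b : nat) (P : 'M[mpoly.mpoly n R]_(a, b)) x
    : 'M[R]_(a, b) :=
  \matrix_(i, j) peval (P i j) x.

Definition basic_semialg (k : nat) (g : 'I_k -> mpoly.mpoly n R)
    : set 'cV[R]_n :=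
  [set x | forall i, 0 <= peval (g i) x].

Definition zeros_prod (m : nat) (h : 'I_m -> mpoly.mpoly n R)
    : set 'cV[R]_n :=
  [set x | \prod_(i < m) peval (h i) x = 0].

Definition frontier (A : set 'cV[R]_n) : set 'cV[R]_n :=
  closure A `\` interior A.

(* The exit set: the topological boundary, with the origin adjoined. *)
Definition exit_set (A : set 'cV[R]_n) : set 'cV[R]_n :=
  frontier A `|` [set 0].

Definition posdef_on (A : set 'cV[R]_n) (w : 'cV[R]_n -> R) : Prop :=
  w 0 = 0 /\ forall x, A x -> x != 0 -> 0 < w x.

End Polynomials.

Section Calculus.
Variables (R : realType) (n : nat).
Implicit Types (u : 'cV[R]_n -> R) (x : 'cV[R]_n).

Definition partial (i : 'I_n) u : 'cV[R]_n -> R :=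
  fun x => 'D_(delta_mx i 0 : 'cV[R]_n) u x.

Definition grad u x : 'cV[R]_n := \col_i partial i u x.
Definition hess u x : 'M[R]_n := \matrix_(i, j) partial i (partial j u) x.

(* A smooth function on a set A that need not be open: continuous on A and
   infinitely differentiable in the interior of A.  This depends only on the
   values of u on A, and holds whenever u extends smoothly to a neighbourhood
   of A. *)
Definition smooth_on (A : set 'cV[R]_n) u : Prop :=
  {within A, continuous u} /\
  forall (s : seq 'I_n) x, interior A x -> differentiable (foldr partial u s) x.

End Calculus.

Section Viscosity.
Variables (R : realType) (n : nat).
Implicit Types (A : set 'cV[R]_n) (u : 'cV[R]_n -> R) (x p : 'cV[R]_n).
Implicit Types (X Y : 'M[R]_n) (F : 'cV[R]_n -> R -> 'cV[R]_n -> 'M[R]_n -> R).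

Definition lsc_on A u : Prop :=
  lower_semicontinuous ((fun x => (u x)%:E) : subspace A -> \bar R).
Definition usc_on A u : Prop := lsc_on A (fun x => - u x).

(* In the jets, o(|y - x|^2) is written out, with y -> x inside A. *)
Definition superjet A u x p X : Prop :=
  sym_mx X /\
  forall e : R, 0 < e -> \forall y \near within A (nbhs x),
    u y <= u x + dotv p (y - x) + 2^-1 * quadf X (y - x) + e * `|y - x| ^+ 2.

Definition subjet A u x p X : Prop :=
  sym_mx X /\
  forall e : R, 0 < e -> \forall y \near within A (nbhs x),
    u x + dotv p (y - x) + 2^-1 * quadf X (y - x) - e * `|y - x| ^+ 2 <= u y.

Definition proper F : Prop :=
  forall x r s p X Y, sym_mx X -> sym_mx Y -> r <= s -> loewner_le Y X ->
    F x r p X <= F x s p Y.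

(* A is the closed domain of a Dirichlet problem: semicontinuity is required
   on all of A, and the equation at the interior points of A.  At a frontier
   point the jets relative to A contain one-sided elements (p, X) with X
   arbitrarily large or small, so that even a smooth classical solution can
   violate the inequality there; the frontier carries the boundary data. *)
Definition viscosity_subsolution F A u : Prop :=
  [/\ proper F, usc_on A u &
      forall x p X, interior A x -> superjet A u x p X -> F x (u x) p X <= 0].

Definition viscosity_supersolution F A u : Prop :=
  [/\ proper F, lsc_on A u &
      forall x p X, interior A x -> subjet A u x p X -> 0 <= F x (u x) p X].

Definition viscosity_solution F A u : Prop :=
  viscosity_subsolution F A u /\ viscosity_supersolution F A u.

Definition nontrivial_on A u : Prop := exists2 x, A x & u x != 0.

Definition nontrivial_dirichlet_solution F A (psi u : 'cV[R]_n -> R) : Prop :=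
  [/\ viscosity_solution F A u, nontrivial_on A u &
      forall x, exit_set A x -> u x = psi x].

(* Functions on A are represented by total functions, so uniqueness is
   equality of the restrictions to A. *)
Definition unique_nontrivial_dirichlet_solution F A
    (psi u : 'cV[R]_n -> R) : Prop :=
  nontrivial_dirichlet_solution F A psi u /\
  forall v, nontrivial_dirichlet_solution F A psi v ->
    forall x, A x -> v x = u x.

End Viscosity.

Section LinearHJB.
Variables (R : realType) (n : nat) (lambda : R).
Variables (q phi : 'cV[R]_n -> R) (f : 'cV[R]_n -> 'cV[R]_n).
Variable Sigma : 'cV[R]_n -> 'M[R]_n.

Definition hjb_L (Psi : 'cV[R]_n -> R) (x : 'cV[R]_n) : R :=
  dotv (f x) (grad Psi x) + 2^-1 * \tr (hess Psi x *m Sigma x).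

Definition hjb_op (x : 'cV[R]_n) (r : R) (p : 'cV[R]_n) (X : 'M[R]_n) : R :=
  lambda^-1 * q x * r - dotv (f x) p - 2^-1 * \tr (X *m Sigma x).

Definition boundary_data (x : 'cV[R]_n) : R := expR (- (phi x / lambda)).

End LinearHJB.

Definition diffusion (R : realType) (n l : nat) (B : 'M[R]_(n, l))
    (Sigma_eps : 'M[R]_l) : 'M[R]_n :=
  B *m Sigma_eps *m B^T.

(* Main.v *)
Require Import Defs.
From HB Require Import structures.
From mathcomp Require Import all_boot all_order all_algebra.
From mathcomp Require Import all_classical all_reals all_analysis.
From mathcomp Require mpoly.
From mathcomp Require Import finmap ring lra.

Set Implicit Arguments.
Unset Strict Implicit.
Unset Printing Implicit Defensive.

Import Order.TTheory GRing.Theory Num.Theory numFieldNormedType.Exports.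

Local Open Scope classical_set_scope.
Local Open Scope ring_scope.

(** A maximum principle. Let [u] be a smooth classical subsolution lying below
    the boundary data, and [w] the viscosity solution. The difference [w - u] is
    lower semicontinuous on the compact domain, so it attains a minimum
    ([lsc_attains_min]). If the minimum is on the exit set, it is nonnegative by
    the boundary conditions. Otherwise it is at an interior point x <> 0, where
    [u], shifted vertically, touches [w] from below; the second-order Taylor
    polynomial of [u] therefore lies in the subjet of [w] ([subjet_touching]) and
    the supersolution inequality for [w] can be read at the gradient and Hessian
    of [u]. Subtracting the classical inequality for [u] leaves
    q(x) (w(x) - u(x)) / lambda >= 0, and q(x) > 0 because x <> 0
    ([classical_sub_le_viscosity_super]). So the supersolution half of the
    definition of [w] bounds smooth subsolutions by [w], and the subsolution half
    bounds smooth supersolutions.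

    That [u] is itself a viscosity subsolution holds because a superjet (p, X) of
    a twice differentiable function has p equal to the gradient and X above the
    Hessian ([superjet_expands2]), and the equation is degenerate elliptic.

    Both arguments rest on the second-order Taylor expansion with a symmetric
    Hessian ([taylor2], [sym_hess]), proved from the mean value theorem on
    segments for functions that are differentiable near a point and have
    differentiable partial derivatives there. The statement about supersolutions
    follows by negation, the equation being linear and homogeneous. *)

(** * Quadratic forms and their germs *)

Section QuadraticForms.
Variables (R : realType) (n : nat).
Implicit Types (u v w : 'cV[R]_n) (X Y : 'M[R]_n).

Lemma dotvE u v : dotv u v = \sum_i u i 0 * v i 0.
Proof. by rewrite /dotv mxE; apply: eq_bigr => i _; rewrite mxE. Qed.

Lemma dotvC u v : dotv u v = dotv v u.
Proof. by rewrite !dotvE; apply: eq_bigr => i _; rewrite mulrC. Qed.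

Lemma dotvDr u v w : dotv u (v + w) = dotv u v + dotv u w.
Proof. by rewrite /dotv mulmxDr mxE. Qed.

Lemma dotvZr a u v : dotv u (a *: v) = a * dotv u v.
Proof. by rewrite /dotv -scalemxAr mxE. Qed.

Lemma dotvDl u v w : dotv (v + w) u = dotv v u + dotv w u.
Proof. by rewrite dotvC dotvDr !(dotvC u). Qed.

Lemma dotvZl a u v : dotv (a *: v) u = a * dotv v u.
Proof. by rewrite dotvC dotvZr dotvC. Qed.

Lemma dotvNl u v : dotv (- v) u = - dotv v u.
Proof. by rewrite -scaleN1r dotvZl mulN1r. Qed.

Lemma dotv_delta i j X : dotv (delta_mx i 0) (X *m delta_mx j 0) = X i j.
Proof. by rewrite /dotv trmx_delta mulmxA -rowE -colE !mxE. Qed.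

Lemma dotv_vv_eq0 v : dotv v v = 0 -> v = 0.
Proof.
rewrite dotvE => vv0; apply/colP => i; rewrite mxE; apply/eqP.
rewrite -sqrf_eq0 expr2; apply/eqP; move: i isT.
by apply: psumr_eq0P vv0 => i _; rewrite -expr2 sqr_ge0.
Qed.

Lemma quadfE X v : quadf X v = dotv v (X *m v).
Proof. by rewrite /quadf /dotv mulmxA. Qed.

Lemma quadfZ X a v : quadf X (a *: v) = a ^+ 2 * quadf X v.
Proof. by rewrite !quadfE -scalemxAr dotvZr dotvZl mulrA. Qed.

Lemma quadfB X Y v : quadf (X - Y) v = quadf X v - quadf Y v.
Proof. by rewrite !quadfE mulmxBl dotvDr -scaleN1r dotvZr mulN1r. Qed.

Lemma quadfN X v : quadf (- X) v = - quadf X v.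
Proof. by rewrite -(sub0r X) quadfB /quadf mulmx0 mul0mx mxE sub0r. Qed.

Lemma sym_mxN X : sym_mx X -> sym_mx (- X).
Proof. by rewrite /sym_mx linearN/= => ->. Qed.

Lemma norm_coord v i : `|v i 0| <= `|v|.
Proof.
rewrite [leRHS]/Num.norm/= mx_normrE.
exact: (le_bigmax _ (fun ij : 'I_n * 'I_1 => `|v ij.1 ij.2|) (i, 0)).
Qed.

Lemma near_ball (x : 'cV[R]_n) (P : set 'cV[R]_n) : (\forall y \near x, P y) ->
  exists2 r : R, 0 < r & forall w, `|w| < r -> P (x + w).
Proof.
move=> /nbhs_ballP[r /= r0 Pr]; exists r => // w wr; apply: Pr.
by rewrite mx_norm_ball /ball_ /= opprD addrA subrr add0r normrN.
Qed.

Lemma near_line (x v : 'cV[R]_n) (P : set 'cV[R]_n) :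
  (\forall y \near x, P y) ->
  exists2 d : R, 0 < d & forall t, `|t| < d -> P (x + t *: v).
Proof.
move=> /near_ball[r r0 Pr]; have v0 : 0 < `|v| + 1 by rewrite ltr_wpDl.
exists (r / (`|v| + 1)) => [|t]; first by rewrite divr_gt0.
rewrite ltr_pdivlMr// => tr; apply: Pr; rewrite normrZ.
by apply: le_lt_trans tr; rewrite ler_wpM2l// lerDl.
Qed.

(** A linear plus quadratic form with nonpositive germ up to o(|y - x|^2):
    along a ray [x + t v] the linear term has order t and dominates for small t,
    so it must vanish in every direction; dividing what is left by t^2 shows
    that the quadratic form is nonpositive. This is what makes the second-order
    jets of a smooth function classical. *)
Lemma quadratic_germ_le0 (x a : 'cV[R]_n) (M : 'M[R]_n) :
  (forall e : R, 0 < e -> \forall y \near x,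
     dotv a (y - x) + 2^-1 * quadf M (y - x) <= e * `|y - x| ^+ 2) ->
  a = 0 /\ forall v, quadf M v <= 0.
Proof.
move=> H.
have line (e : R) v : 0 < e -> exists2 d : R, 0 < d & forall t, `|t| < d ->
    t * dotv a v + 2^-1 * t ^+ 2 * quadf M v <= e * `|v| ^+ 2 * t ^+ 2.
  move=> /H/(near_line v)[d d0 Hd]; exists d => // t /Hd.
  rewrite (addrC x) addrK dotvZr quadfZ normrZ exprMn real_normK ?num_real//.
  by lra.
have a_le0 v : dotv a v <= 0.
  have [d d0 Hd] := line 1 v ltr01; rewrite leNgt; apply/negP => av0.
  set C := `|v| ^+ 2 - 2^-1 * quadf M v.
  have C0 : 0 < `|C| + 1 by rewrite ltr_wpDl.
  (* Small enough for the hypothesis, and for the quadratic term to be at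
     most half of the linear one. *)
  pose t := Num.min (d / 2) (dotv a v / 2 / (`|C| + 1)).
  have t0 : 0 < t by rewrite lt_min !divr_gt0.
  have td : t < d.
    apply: (@le_lt_trans _ _ (d / 2)); first by rewrite ge_min lexx.
    by rewrite ltr_pdivrMr// ltr_pMr// ltr1n.
  have tC : t * (`|C| + 1) <= dotv a v / 2.
    by rewrite -ler_pdivlMr// ge_min lexx orbT.
  have /Hd : `|t| < d by rewrite gtr0_norm.
  rewrite mul1r => Ht.
  have : t * dotv a v <= t * (t * C) by rewrite /C; lra.
  rewrite ler_pM2l// => {}Ht.
  have : t * C <= t * (`|C| + 1).
    by rewrite ler_pM2l// (le_trans (ler_norm _))// lerDl.
  by lra.
have a0 : a = 0.
  apply: dotv_vv_eq0; apply/eqP; rewrite eq_le a_le0/=.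
  by have := a_le0 (- a); rewrite -scaleN1r dotvZr mulN1r oppr_le0.
split=> // v; apply/ler_addgt0Pr => e e0.
(* The factor 2 undoes the 1/2 of the quadratic term; the + 1 covers v = 0. *)
have v0 : 0 < 2 * (`|v| ^+ 2 + 1) by rewrite mulr_gt0// ltr_wpDl// sqr_ge0.
have [d d0 Hd] := line (e / (2 * (`|v| ^+ 2 + 1))) v (divr_gt0 e0 v0).
have /Hd : `|d / 2| < d.
  by rewrite gtr0_norm ?divr_gt0// ltr_pdivrMr// ltr_pMr// ltr1n.
rewrite a0 /dotv trmx0 mul0mx mxE mulr0 add0r.
rewrite mulrAC ler_pM2r ?exprn_gt0 ?divr_gt0//.
set K := e / _ * _ => HK.
have : K <= e / 2.
  rewrite /K invfM (mulrA e) -(mulrA (e / 2)); apply: ler_piMr.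
    by rewrite divr_ge0// ltW.
  by rewrite ler_pdivrMl ?ltr_wpDl ?sqr_ge0// mulr1 lerDl.
by lra.
Qed.

End QuadraticForms.

(** * Second-order Taylor expansion *)

Section FirstOrder.
Variables (R : realType) (n : nat) (u : 'cV[R]_n -> R) (x : 'cV[R]_n).
Implicit Types (v w y : 'cV[R]_n).

Lemma derive_dotv y v : differentiable u y -> 'D_v u y = dotv (grad u y) v.
Proof.
move=> du; rewrite deriveE//.
have -> : v = \sum_i v i 0 *: delta_mx i 0.
  by rewrite [LHS]matrix_sum_delta; apply: eq_bigr => i _; rewrite big_ord1.
rewrite linear_sum dotvE; apply: eq_bigr => i _.
rewrite linearZ/= mxE /partial deriveE// mulrC; congr (_ * _).
rewrite summxE (bigD1 i)//= big1 => [|j ji]; last first.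
  by rewrite !mxE eq_sym (negPf ji) mulr0.
by rewrite !mxE !eqxx addr0 mulr1.
Qed.

Lemma is_derive_line y w (t : R) : differentiable u (y + t *: w) ->
  is_derive t (1 : R) (fun s : R => u (y + s *: w)) ('D_w u (y + t *: w)).
Proof.
move=> du; rewrite deriveE//.
have dl : is_diff t (fun s : R => y + s *: w) (fun s : R => s *: w).
  have := is_diffD (is_diff_cst y t) (is_diff_scalel t w).
  by rewrite add0r.
have dc : is_diff t (u \o (fun s : R => y + s *: w))
    ('d u (y + t *: w) \o (fun s : R => s *: w)).
  by apply: is_diff_comp; exact: differentiableP.
apply: DeriveDef; first by apply/derivable1_diffP; apply: ex_diff.
by rewrite deriveE ?diff_val /= ?scale1r//; apply: ex_diff.
Qed.

Lemma diff_near0 (e : R) : differentiable u x -> 0 < e ->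
  \forall w \near (0 : 'cV[R]_n),
    `|u (x + w) - (u x + dotv (grad u x) w)| <= e * `|w|.
Proof.
move=> dux e0; have /diff_locally/eqaddoP/(_ e e0) := dux.
apply: filterS => w /=.
rewrite !fctE /= /cst (addrC w) -derive_dotv// deriveE//.
Qed.

End FirstOrder.

Section SecondOrder.
Variables (R : realType) (n : nat) (u : 'cV[R]_n -> R) (x : 'cV[R]_n).
Implicit Types (v w y : 'cV[R]_n).

Hypothesis du : \forall y \near x, differentiable u y.
Hypothesis ddu : forall i, differentiable (partial i u) x.

(** First-order expansion at [x] of all directional derivatives at once, with an
    error uniform in the direction [v]: the mean value arguments below evaluate it at
    intermediate points that they do not control. *)
Lemma derive_expansion (e : R) : 0 < e -> exists2 r : R, 0 < r &
  forall w v, `|w| < r -> differentiable u (x + w) /\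
   `|'D_v u (x + w) - ('D_v u x + dotv w (hess u x *m v))| <= e * `|w| * `|v|.
Proof.
move=> e0; pose e' := e / n.+1%:R.
have e'0 : 0 < e' by rewrite divr_gt0.
have : \forall w \near (0 : 'cV[R]_n), forall i,
    `|partial i u (x + w) - (partial i u x + dotv (grad (partial i u) x) w)|
    <= e' * `|w|.
  exact: filter_forall (fun i => diff_near0 (ddu i) e'0).
move=> /near_ball[r1 r10 H1]; have [r2 r20 H2] := near_ball du.
exists (Num.min r1 r2) => [|w v]; first by rewrite lt_min r10.
rewrite lt_min => /andP[/H1 + /H2 dw]; rewrite add0r => Hw; split=> //.
rewrite !derive_dotv//; last by have := nbhs_singleton du.
have -> : dotv (grad u (x + w)) v
      - (dotv (grad u x) v + dotv w (hess u x *m v))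
    = \sum_i (partial i u (x + w)
        - (partial i u x + dotv (grad (partial i u) x) w)) * v i 0.
  have -> : dotv w (hess u x *m v)
      = \sum_i dotv (grad (partial i u) x) w * v i 0.
    rewrite dotvE; under eq_bigr do rewrite mxE mulr_sumr.
    rewrite exchange_big/=; apply: eq_bigr => j _.
    rewrite dotvE mulr_suml; apply: eq_bigr => i _.
    by rewrite !mxE mulrCA mulrA.
  rewrite !dotvE -big_split -sumrB/=; apply: eq_bigr => i _.
  by rewrite !mxE -mulrDl -mulrBl.
apply: le_trans (ler_norm_sum _ _ _) _.
apply: (@le_trans _ _ (\sum_(i < n) e' * `|w| * `|v|)).
  by apply: ler_sum => i _; rewrite normrM ler_pM ?norm_coord.
rewrite sumr_const card_ord -mulr_natl !mulrA ler_wpM2r// ler_wpM2r//.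
rewrite mulrAC ler_piMl ?(ltW e0)// ler_pdivrMr// mul1r ler_nat.
exact: leqnSn.
Qed.

(** The mean value theorem, applied to the Taylor remainder along the segment
    from [x] to [y], turns it into the remainder of the first-order expansion of
    the gradient. *)
Lemma taylor2 (e : R) : 0 < e -> \forall y \near x,
  `|u y - (u x + dotv (grad u x) (y - x) + 2^-1 * quadf (hess u x) (y - x))|
  <= e * `|y - x| ^+ 2.
Proof.
move=> e0; have [r r0 Hr] := derive_expansion e0.
near=> y; set w := y - x; set H := hess u x.
have wr : `|w| < r.
  rewrite /w -normrN opprB; near: y; exact: cvgr_dist_lt.
have cw (c : R) : 0 <= c -> c <= 1 -> `|c *: w| <= `|w|.
  by move=> c0 c1; rewrite normrZ ger0_norm// ler_piMl.
pose D c := 'D_w u (x + c *: w) - dotv (grad u x) w - c * quadf H w.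
pose g (c : R) :=
  u (x + c *: w) - c * dotv (grad u x) w - 2^-1 * c ^+ 2 * quadf H w.
have gD (c : R) : 0 <= c -> c <= 1 -> is_derive c (1 : R) g (D c).
  move=> c0 c1; have du' : differentiable u (x + c *: w).
    by have [] := Hr (c *: w) 0 (le_lt_trans (cw _ c0 c1) wr).
  have dl := is_derive_line du'.
  have -> : g = (fun s : R => u (x + s *: w))
      - dotv (grad u x) w *: (id : R -> R)
      - (2^-1 * quadf H w) *: ((id : R -> R) ^+ 2).
    by apply/funext => s; rewrite /g !fctE /=; rewrite /GRing.scale/=; ring.
  have dq := is_deriveX 2 (is_derive_id c (1 : R)).
  have dk := is_deriveZ (dotv (grad u x) w) (is_derive_id c (1 : R)).
  have dq2 := is_deriveZ (2^-1 * quadf H w) dq.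
  have d3 := is_deriveB (is_deriveB dl dk) dq2.
  apply: (is_derive_eq d3).
  by rewrite /D /GRing.scale/= expr1; field.
have [c c01 gc] : exists2 c : R, c \in `]0, 1[ & g 1 - g 0 = D c * (1 - 0).
  apply: MVT => //.
    by move=> c /[!in_itv]/= /andP[/ltW c0 /ltW c1]; exact: gD.
  apply: derivable_within_continuous => c /[!in_itv]/= /andP[c0 c1].
  by have [] := gD _ c0 c1.
move: c01 gc; rewrite in_itv/= => /andP[c0 c1].
rewrite /g expr0n/= !mulr0 !mul0r !subr0 scale0r addr0 scale1r expr1n.
rewrite !mulr1 mul1r.
have xw : x + w = y by rewrite addrC subrK.
rewrite xw => gc.
have -> : u y - (u x + dotv (grad u x) w + 2^-1 * quadf H w) = D c.
  by rewrite -gc; ring.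
have [_] := Hr (c *: w) w (le_lt_trans (cw _ (ltW c0) (ltW c1)) wr).
rewrite (derive_dotv (y := x)); last by have := nbhs_singleton du.
rewrite dotvZl -quadfE opprD addrA => /le_trans; apply.
rewrite expr2 mulrA ler_wpM2r// ler_pM2l// cw// ltW.
Unshelve. all: by end_near.
Qed.

(** The mean value theorem for [s |-> u (x + a + s b) - u (x + s b)] turns the
    second difference into a difference of two derivatives in the direction [b],
    at two points that differ by [a]. *)
Lemma second_difference (e : R) : 0 < e -> exists2 r : R, 0 < r &
  forall a b, `|a| + `|b| < r ->
  `|u (x + a + b) - u (x + a) - (u (x + b) - u x) - dotv a (hess u x *m b)|
  <= 2 * e * (`|a| + `|b|) ^+ 2.
Proof.
move=> e0; have [r r0 Hr] := derive_expansion e0; exists r => // a b abr.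
have sb (s : R) : 0 <= s -> s <= 1 -> `|s *: b| <= `|b|.
  by move=> s0 s1; rewrite normrZ ger0_norm// ler_piMl.
have ab (s : R) : 0 <= s -> s <= 1 -> `|a + s *: b| <= `|a| + `|b|.
  by move=> s0 s1; rewrite (le_trans (ler_normD _ _))// lerD2l sb.
have bab : `|b| <= `|a| + `|b| by rewrite lerDr.
have Hab s s0 s1 := Hr (a + s *: b) b (le_lt_trans (ab s s0 s1) abr).
have Hb s s0 s1 := Hr (s *: b) b (le_lt_trans (le_trans (sb s s0 s1) bab) abr).
pose g (s : R) := u (x + a + s *: b) - u (x + s *: b).
pose D (s : R) := 'D_b u (x + a + s *: b) - 'D_b u (x + s *: b).
have gD (s : R) : 0 <= s -> s <= 1 -> is_derive s (1 : R) g (D s).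
  move=> s0 s1; apply: is_deriveB; apply: is_derive_line.
    by rewrite -addrA; have [] := Hab s s0 s1.
  by have [] := Hb s s0 s1.
have [s s01 gs] : exists2 s : R, s \in `]0, 1[ & g 1 - g 0 = D s * (1 - 0).
  apply: MVT => //.
    by move=> s /[!in_itv]/= /andP[/ltW s0 /ltW s1]; exact: gD.
  apply: derivable_within_continuous => s /[!in_itv]/= /andP[s0 s1].
  by have [] := gD _ s0 s1.
move: s01 gs; rewrite in_itv/= => /andP[/ltW s0 /ltW s1].
rewrite /g !scale0r !addr0 !scale1r subr0 mulr1 => gs.
have -> : u (x + a + b) - u (x + a) - (u (x + b) - u x) = D s.
  by rewrite -gs; ring.
have [_ H1] := Hab s s0 s1; have [_ H2] := Hb s s0 s1.
have -> : D s - dotv a (hess u x *m b) =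
    ('D_b u (x + (a + s *: b)) - ('D_b u x + dotv (a + s *: b) (hess u x *m b)))
  - ('D_b u (x + s *: b) - ('D_b u x + dotv (s *: b) (hess u x *m b))).
  by rewrite dotvDl /D addrA; ring.
apply: le_trans (ler_normB _ _) _; set N := `|a| + `|b|.
rewrite (_ : 2 * e * _ = e * N * N + e * N * N); last by ring.
apply: lerD; [apply: le_trans H1 _|apply: le_trans H2 _].
  by rewrite ler_pM ?mulr_ge0 ?(ltW e0)// ler_wpM2l ?(ltW e0)// ab.
rewrite ler_pM ?mulr_ge0 ?(ltW e0)// ler_wpM2l ?(ltW e0)//.
exact: le_trans (sb _ s0 s1) bab.
Qed.

(** Schwarz's theorem: the second difference is symmetric in its two increments,
    and so is its quadratic approximation, as scaling the increments shows. *)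
Lemma bilinear_hess_sym v w :
  dotv v (hess u x *m w) = dotv w (hess u x *m v).
Proof.
apply/eqP; rewrite -subr_eq0 -normr_le0; apply/ler_addgt0Pr => e e0.
rewrite add0r; set N := `|v| + `|w| + 1.
have N0 : 0 < N by rewrite ltr_wpDl// addr_ge0.
have e'0 : 0 < e / (4 * N ^+ 2) by rewrite divr_gt0// mulr_gt0// exprn_gt0.
have [r r0 Hr] := second_difference e'0.
have [t t0 tN] : exists2 t : R, 0 < t & t * N = r.
  by exists (r / N); rewrite ?divr_gt0// divfK// gt_eqF.
have tE : `|t *: v| + `|t *: w| = t * (`|v| + `|w|).
  by rewrite !normrZ !(gtr0_norm t0) mulrDr.
have small : t * (`|v| + `|w|) < r.
  by rewrite -tN ltr_pM2l// ltrDl.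
have := Hr (t *: v) (t *: w); rewrite tE => /(_ small) H1.
have := Hr (t *: w) (t *: v); rewrite (addrC `|_|) tE => /(_ small) H2.
rewrite (addrAC x) in H2.
set d := _ - _ : R.
have : t ^+ 2 * `|d| <= t ^+ 2 * e.
  rewrite -[X in X * `|d|]gtr0_norm ?exprn_gt0// -normrM.
  have -> : t ^+ 2 * d =
        (u (x + t *: v + t *: w) - u (x + t *: w) - (u (x + t *: v) - u x)
         - dotv (t *: w) (hess u x *m (t *: v)))
      - (u (x + t *: v + t *: w) - u (x + t *: v) - (u (x + t *: w) - u x)
         - dotv (t *: v) (hess u x *m (t *: w))).
    by rewrite /d -!scalemxAr !dotvZl !dotvZr; ring.
  rewrite (le_trans (ler_normB _ _))// (le_trans (lerD H2 H1))//.
  have -> : 2 * (e / (4 * N ^+ 2)) * (t * (`|v| + `|w|)) ^+ 2 +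
    2 * (e / (4 * N ^+ 2)) * (t * (`|v| + `|w|)) ^+ 2 =
    t ^+ 2 * e * ((`|v| + `|w|) ^+ 2 / N ^+ 2).
    by field; rewrite gt_eqF.
  apply: ler_piMr; first by rewrite mulr_ge0 ?sqr_ge0// ltW.
  rewrite ler_pdivrMr ?exprn_gt0// mul1r.
  by rewrite ler_sqr ?nnegrE ?addr_ge0// lerDl.
by rewrite ler_pM2l ?exprn_gt0.
Qed.

Lemma sym_hess : sym_mx (hess u x).
Proof.
apply/matrixP => i j.
by rewrite mxE -dotv_delta bilinear_hess_sym dotv_delta.
Qed.

End SecondOrder.

(** * Lower semicontinuous functions on compact sets *)

Section Semicontinuity.
Variables (R : realType) (n : nat) (A : set 'cV[R]_n).
Implicit Types (u w : 'cV[R]_n -> R) (x : 'cV[R]_n).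

Lemma lsc_onP u x (e : R) : lsc_on A u -> A x -> 0 < e ->
  \forall y \near within A (nbhs x), u x - e < u y.
Proof.
move=> lu Ax e0.
have [|V] := lu x (u x - e); first by rewrite lte_fin ltrBlDr ltrDl.
rewrite (nbhs_subspace_in Ax) => Vx VP.
by apply: filterS Vx => y /VP; rewrite lte_fin.
Qed.

Lemma continuous_lsc_on u : {within A, continuous u} -> lsc_on A u.
Proof.
move=> cu x a; rewrite lte_fin => au.
exists [set y | a < u y] => [|y /=]; last by rewrite lte_fin.
by apply: (cu x [set z | a < z]); exact: lt_nbhsr.
Qed.

Lemma continuous_usc_on u : {within A, continuous u} -> usc_on A u.
Proof.
move=> cu; apply: continuous_lsc_on => x; apply: continuousN; exact: cu.
Qed.

Lemma lsc_onD u w : lsc_on A u -> lsc_on A w -> lsc_on A (u \+ w).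
Proof.
move=> lu lw x a; rewrite lte_fin => /= auw.
pose e := (u x + w x - a) / 2.
have e0 : 0 < e by rewrite divr_gt0// subr_gt0.
have [|U Ux HU] := lu x (u x - e); first by rewrite lte_fin ltrBlDr ltrDl.
have [|W Wx HW] := lw x (w x - e); first by rewrite lte_fin ltrBlDr ltrDl.
exists (U `&` W) => [|y [/HU + /HW]]; first exact: filterI.
rewrite !lte_fin => uy wy /=.
by move: (ltrD uy wy); rewrite /e; lra.
Qed.

(** Weierstrass for lower semicontinuous functions: without a minimizer the sets
    where [w] exceeds one of its values would cover [A], and the smallest of the
    finitely many values of a subcover would exceed itself. *)
Lemma lsc_attains_min w : compact A -> A !=set0 -> lsc_on A w ->
  exists2 x, A x & forall y, A y -> w x <= w y.
Proof.
rewrite compact_cover => cA [a Aa] lw; apply: contrapT => nomin.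
have below x : A x -> exists2 y, A y & w y < w x.
  move=> Ax; apply: contrapT => H; apply: nomin; exists x => // y Ay.
  by rewrite leNgt; apply/negP => wyx; apply: H; exists y.
pose U b := [set x | A x -> w b < w x]°.
have [||D DA cov] := cA _ A U; first by move=> b _; exact: open_interior.
  move=> x Ax; have [b Ab bx] := below x Ax; exists b => //.
  have e0 : 0 < w x - w b by rewrite subr_gt0.
  have := lsc_onP lw Ax e0; rewrite /U /interior/= near_withinE.
  by apply: filterS => y + Ay => /(_ Ay); rewrite opprB addrC subrK.
have [d Dd _] := cov a Aa.
have [/= m _ minm] :=
  @arg_minP _ _ _ (FSetSub Dd) predT (fun i => w (val i)) isT.
have Am : A (val m) by exact: set_mem (DA _ (valP m)).
have [b Db /interior_subset/(_ Am)] := cov _ Am.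
by rewrite ltNge (minm (FSetSub Db)).
Qed.

End Semicontinuity.

(** * Viscosity solutions and smooth functions *)

Section Comparison.
Variables (R : realType) (n : nat).
Implicit Types (A : set 'cV[R]_n) (u w : 'cV[R]_n -> R) (x p : 'cV[R]_n).
Implicit Types (X : 'M[R]_n) (F : 'cV[R]_n -> R -> 'cV[R]_n -> 'M[R]_n -> R).

(** [u] has second-order Taylor polynomial (p, X) at [x]: (p, X) is in both jets
    of [u]. Unlike smoothness in terms of iterated partial derivatives, this is
    visibly stable under negation, which is how the results on subsolutions are
    transferred to supersolutions. *)
Definition expands2 u x p X : Prop :=
  sym_mx X /\ forall e : R, 0 < e -> \forall y \near x,
    `|u y - (u x + dotv p (y - x) + 2^-1 * quadf X (y - x))|
    <= e * `|y - x| ^+ 2.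

Lemma smooth_expands2 A u x : smooth_on A u -> A° x ->
  expands2 u x (grad u x) (hess u x).
Proof.
move=> [_ su] Ax.
have du : \forall y \near x, differentiable u y.
  by apply: filterS (nbhs_interior Ax) => y; exact: (su [::]).
have ddu i : differentiable (partial i u) x by exact: (su [:: i]).
by split=> [|e e0]; [exact: sym_hess|exact: taylor2].
Qed.

(** At a point where [u] has a Taylor polynomial its superjets have the classical
    gradient and a Hessian that is at least the classical one. *)
Lemma superjet_expands2 A u x p q X Y : A° x -> expands2 u x q Y ->
  superjet A u x p X -> p = q /\ loewner_le Y X.
Proof.
move=> Ax [_ hY] [_ hX].
suff [/eqP + YX] : q - p = 0 /\ forall v, quadf (Y - X) v <= 0.
  by rewrite subr_eq0 => /eqP ->; split=> // v; rewrite -subr_le0 -quadfB.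
apply: (@quadratic_germ_le0 _ _ x) => e e0.
have e20 : 0 < e / 2 by rewrite divr_gt0.
have := hX _ e20; rewrite near_withinE => h1.
apply: filterS (filterI (filterI h1 Ax) (hY _ e20)) => y [[+ Ay] +].
move=> /(_ Ay) h; rewrite ler_norml => /andP[h2 _].
by rewrite dotvDl dotvNl quadfB; lra.
Qed.

Lemma classical_subsolution F A u
    (p : 'cV[R]_n -> 'cV[R]_n) (X : 'cV[R]_n -> 'M[R]_n) :
  Defs.proper F -> {within A, continuous u} ->
  (forall x, A° x -> expands2 u x (p x) (X x)) ->
  (forall x, A° x -> F x (u x) (p x) (X x) <= 0) ->
  viscosity_subsolution F A u.
Proof.
move=> pF cu eu Fu; split=> [//||x q Y Ax jY]; first exact: continuous_usc_on.
have [-> XY] := superjet_expands2 Ax (eu x Ax) jY.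
by apply: le_trans (Fu x Ax); apply: pF => //; [case: jY|case: (eu x Ax)].
Qed.

(** Where [w - u] is minimal, [u] shifted vertically touches [w] from below, so
    the Taylor polynomial of [u] is an admissible test jet for [w]. *)
Lemma subjet_touching A u w x p X : expands2 u x p X ->
  (forall y, A y -> w x - u x <= w y - u y) -> subjet A w x p X.
Proof.
move=> [sX uX] min; split=> // e e0; rewrite near_withinE.
apply: filterS (uX e e0) => y + /min; rewrite ler_norml => /andP[+ _].
by lra.
Qed.

(** Comparison with one smooth side. At a minimum of [w - u] outside the exit set
    the Taylor polynomial of [u] tests [w], so that the same (p, X) gives
    F x (u x) p X <= 0 <= F x (w x) p X; strict monotonicity of [F] in its second
    argument then forbids w x < u x. *)
Lemma classical_sub_le_viscosity_super F A u w
    (p : 'cV[R]_n -> 'cV[R]_n) (X : 'cV[R]_n -> 'M[R]_n) :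
  compact A -> {within A, continuous u} ->
  (forall x, A° x -> expands2 u x (p x) (X x)) ->
  (forall x, A° x -> F x (u x) (p x) (X x) <= 0) ->
  viscosity_supersolution F A w ->
  (forall x r s q Y, A° x -> x != 0 -> r < s -> F x r q Y < F x s q Y) ->
  (forall x, exit_set A x -> u x <= w x) ->
  forall x, A x -> u x <= w x.
Proof.
move=> cA cu eu Fu [_ lw Fw] incF bd x Ax.
have [x0 Ax0 min] : exists2 x0, A x0 &
    forall y, A y -> w x0 - u x0 <= w y - u y.
  apply: lsc_attains_min => //; first by exists x.
  by apply: lsc_onD => //; exact: continuous_usc_on.
rewrite -subr_ge0 (le_trans _ (min _ Ax))// subr_ge0 leNgt; apply/negP => wu.
have Nex : ~ exit_set A x0 by move=> /bd; rewrite leNgt wu.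
have x00 : x0 != 0 by apply/eqP => x00; apply: Nex; right.
have Aix0 : A° x0.
  by apply: contrapT => NA; apply: Nex; left; split=> //; exact: subset_closure.
have := Fw x0 _ _ Aix0 (subjet_touching (eu x0 Aix0) min).
by rewrite leNgt (lt_le_trans (incF _ _ _ _ _ Aix0 x00 wu))// Fu.
Qed.

Lemma expands2N u x p X : expands2 u x p X ->
  expands2 (fun y => - u y) x (- p) (- X).
Proof.
move=> [sX uX]; split=> [|e e0]; first exact: sym_mxN.
apply: filterS (uX e e0) => y /=; rewrite dotvNl quadfN.
set r := 2^-1 * quadf X _ => uy.
rewrite (_ : _ - _ = - (u y - (u x + dotv p (y - x) + r))) ?normrN//.
by rewrite /r; ring.
Qed.

(** For an equation that is odd in (r, p, X), as a linear homogeneous one is,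
    negation exchanges subsolutions and supersolutions. *)
Lemma viscosity_supersolutionN F A u :
  (forall x r p X, F x (- r) (- p) (- X) = - F x r p X) ->
  viscosity_subsolution F A (fun x => - u x) -> viscosity_supersolution F A u.
Proof.
move=> oF [pF uu Fu]; split=> // [|x p X Ax [sX jX]].
  by under [u]eq_fun do rewrite -[u _]opprK.
rewrite -oppr_le0 -oF; apply: Fu => //; split=> [|e /jX]; first exact: sym_mxN.
by apply: filterS => y; rewrite dotvNl quadfN; lra.
Qed.

Lemma viscosity_subsolutionN F A u :
  (forall x r p X, F x (- r) (- p) (- X) = - F x r p X) ->
  viscosity_subsolution F A u -> viscosity_supersolution F A (fun x => - u x).
Proof.
move=> oF; have {1}-> : u = fun x => - - u x.
  by apply/funext => x; rewrite opprK.
exact: viscosity_supersolutionN.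
Qed.

End Comparison.

(** * Bounds for the linear Hamilton-Jacobi-Bellman equation *)

Theorem theorem3p5 (R : realType) (n m' l k m : nat)
  (g : 'I_k -> mpoly.mpoly n R) (h : 'I_m -> mpoly.mpoly n R)
  (f : 'cV[mpoly.mpoly n R]_n) (G : 'M[mpoly.mpoly n R]_(n, m'))
  (B : 'M[mpoly.mpoly n R]_(n, l)) (phi q : mpoly.mpoly n R)
  (Rcost : 'M[R]_m') (Sigma_eps : 'M[R]_l) (lambda : R)
  (Psi_star : 'cV[R]_n -> R) :
  let Omega := basic_semialg g in
  let Sigma := fun x => diffusion (peval_mx B x) Sigma_eps in
  let F := hjb_op lambda (peval q) (peval_mx f) Sigma in
  let L := hjb_L (peval_mx f) Sigma in
  let psi := boundary_data lambda (peval phi) in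
  compact Omega ->
  Omega 0 ->
  exit_set Omega = zeros_prod h `|` [set 0] ->
  peval_mx f 0 = 0 ->
  peval_mx G 0 = 0 ->
  peval_mx B 0 = 0 ->
  possemidef_mx Sigma_eps ->
  posdef_mx Rcost ->
  (forall x, 0 <= peval phi x) ->
  (forall x, 0 <= peval q x) ->
  posdef_on Omega (peval phi) ->
  posdef_on Omega (peval q) ->
  (forall x, exit_set Omega x -> x != 0 -> 0 < peval phi x) ->
  0 < lambda ->
  (forall x, lambda *: (peval_mx G x *m invmx Rcost *m (peval_mx G x)^T)
             = Sigma x) ->
  unique_nontrivial_dirichlet_solution F Omega psi Psi_star ->
  (forall Psi_l : 'cV[R]_n -> R,
     smooth_on Omega Psi_l ->
     (forall x, interior Omega x ->
        lambda^-1 * peval q x * Psi_l x - L Psi_l x <= 0) ->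
     (forall x, exit_set Omega x -> Psi_l x <= psi x) ->
     viscosity_subsolution F Omega Psi_l /\
     (forall x, Omega x -> Psi_l x <= Psi_star x)) /\
  (forall Psi_u : 'cV[R]_n -> R,
     smooth_on Omega Psi_u ->
     (forall x, interior Omega x ->
        0 <= lambda^-1 * peval q x * Psi_u x - L Psi_u x) ->
     (forall x, exit_set Omega x -> psi x <= Psi_u x) ->
     viscosity_supersolution F Omega Psi_u /\
     (forall x, Omega x -> Psi_star x <= Psi_u x)).
Proof.
move=> Omega Sigma F L psi cO _ _ _ _ _ _ _ _ _ _ qpos _ l0 _.
move=> [[[subS superS] _ bdS] _].
(* Degenerate ellipticity is part of the hypothesis that Psi_star is a viscosity
   solution. *)
have pF : Defs.proper F by case: subS.
have oF x r p X : F x (- r) (- p) (- X) = - F x r p X.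
  rewrite /F /hjb_op (dotvC _ (- p)) dotvNl (dotvC p) mulNmx linearN/=.
  by ring.
(* The zero-order coefficient q / lambda vanishes at the origin, where the
   comparison relies on the boundary data instead. *)
have incF x r s p X : Omega° x -> x != 0 -> r < s -> F x r p X < F x s p X.
  move=> Ox x0 rs; rewrite /F /hjb_op !ltrD2r ltr_pM2l// mulr_gt0 ?invr_gt0//.
  by apply: qpos.2 => //; exact: interior_subset.
have FE u x : F x (u x) (grad u x) (hess u x)
    = lambda^-1 * peval q x * u x - L u x.
  by rewrite /F /hjb_op /L /hjb_L opprD addrA.
split=> u su Fu bu.
  have eu := fun x => smooth_expands2 (x := x) su.
  have Fu' x : Omega° x -> F x (u x) (grad u x) (hess u x) <= 0.
    by rewrite FE; exact: Fu.
  split; first exact: classical_subsolution pF su.1 eu Fu'.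
  apply: (classical_sub_le_viscosity_super cO su.1 eu Fu' superS incF).
  by move=> x ex; rewrite bdS//; exact: bu.
(* The second half is the first one for - u, compared with - Psi_star. *)
pose v x := - u x; pose pv x := - grad u x; pose Xv x := - hess u x.
have cv : {within Omega, continuous v}.
  by move=> x; apply: continuousN; exact: su.1.
have ev x : Omega° x -> expands2 v x (pv x) (Xv x).
  by move=> Ox; apply: expands2N; exact: smooth_expands2 su Ox.
have Fv x : Omega° x -> F x (v x) (pv x) (Xv x) <= 0.
  by move=> Ox; rewrite oF oppr_le0 FE; exact: Fu.
split.
  apply: viscosity_supersolutionN => //.
  exact: classical_subsolution pF cv ev Fv.
move=> x Ox; rewrite -lerN2.
have superNS := viscosity_subsolutionN oF subS.
apply: (classical_sub_le_viscosity_super cO cv ev Fv superNS incF) Ox.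
by move=> {}x ex; rewrite lerN2 bdS//; exact: bu.
Qed.
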